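(* There is an absolute constant $C>0$ such that the following holds. Let $n>m\ge 1$ be integers, let $q(z)=\sum_{k=0}^m c_k z^k$ be a polynomial of degree $m$ all of whose coefficients satisfy $|c_k|=1$ and with $q(0)=c_0=1$, and let $p(z)=z^n+q(z)$. Then the harmonic polynomial $p(z)+\overline{q(z)}$ has at most $C\,n^{3/2}$ zeros in $\mathbb{C}$.
   Context: A zero of $p+\overline{q}$ is a point $z\in\mathbb{C}$ with $p(z)+\overline{q(z)}=0$. *)

(* Defs.v *)
From HB Require Import structures.
From mathcomp Require Import all_boot all_order all_algebra.
From mathcomp Require Import complex.
From mathcomp Require Import reals.
Set Implicit Arguments. Unset Strict Implicit. Unset Printing Implicit Defensive.
Import Order.TTheory GRing.Theory Num.Theory.
Local Open Scope ring_scope.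

Definition harm_zero (R : realType) (p q : {poly R[i]}) (z : R[i]) : Prop :=
  p.[z] + conjc q.[z] = 0.

(* Main.v *)
(** A zero z of z^n + 2 Re q(z) has z^n real, so it lies on one of 2n rays.  On
    the ray with direction w, the modulus r is a positive root of a real
    polynomial of degree n with coefficients in [-2, 2], constant term 2 and
    leading coefficient 1 or -1.  It remains to see that such a polynomial
    f = sum a_i x^i has O(sqrt n) roots in (0, 1]; the roots above 1 are those
    of the reversed polynomial.  By Rolle's theorem for x^(-k) f, the operator
    f |-> k f - x f' loses at most one root in (0, 1] and multiplies a_i by
    k - i.  If f has more than N roots, applying it for N values k leaves a root
    x in (0, 1] of sum a_i P(i) x^i, where P(t) = prod (k - t), so that
    |a_0 P(0)| <= sum_(i >= 1) |a_i P(i)|.  This fails when P(t) is the fourth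
    power of the Chebyshev polynomial U_(l-1)(1 - t/n) with l about 2 sqrt n,
    since (1 - x^2) U_(l-1)(x)^2 <= 1 and U_(l-1)(1) = l. *)

Require Import Defs.
From HB Require Import structures.
From mathcomp Require Import all_boot all_order all_algebra.
From mathcomp Require Import complex.
From mathcomp Require Import reals.
From mathcomp Require Import ring lra.
From mathcomp Require Import normedtype derive realfun exp trigo.
Set Implicit Arguments. Unset Strict Implicit. Unset Printing Implicit Defensive.
Import Order.TTheory GRing.Theory Num.Theory.
Import numFieldNormedType.Exports.
Local Open Scope ring_scope.

(** * The operator [k f - x f'] and the loss of at most one root *)

Definition euler_op {R : nzRingType} (k : R) (f : {poly R}) : {poly R} :=
  k *: f - 'X * f^`().

Lemma coef_euler_op (R : comNzRingType) (k : R) (f : {poly R}) i :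
  (euler_op k f)`_i = (k - i%:R) * f`_i.
Proof.
rewrite coefB coefZ coefXM mulrBl; case: i => [|i] /=; first by rewrite mul0r.
by rewrite coef_deriv mulr_natl.
Qed.

Lemma coef_foldr_euler_op (R : comNzRingType) (ks : seq R) (f : {poly R}) i :
  (foldr euler_op f ks)`_i = (\prod_(k <- ks) (k - i%:R)) * f`_i.
Proof.
elim: ks => [|k ks IH] /=; first by rewrite big_nil mul1r.
by rewrite coef_euler_op IH big_cons mulrA.
Qed.

Lemma size_foldr_euler_op (R : comNzRingType) (ks : seq R) (f : {poly R}) :
  (size (foldr euler_op f ks) <= size f)%N.
Proof.
by apply/leq_sizeP => i /(nth_default 0) fi; rewrite coef_foldr_euler_op fi mulr0.
Qed.

(* [euler_op k f] is [- x^(k+1) * (x^(-k) * f)^`], so this is Rolle's theorem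
   for [x^(-k) * f]. *)
Lemma euler_op_rolle (R : realType) (k : R) (f : {poly R}) (a b : R) :
  0 < a -> a < b -> root f a -> root f b ->
  exists2 c, a < c < b & root (euler_op k f) c.
Proof.
move=> a0 ab /rootP fa /rootP fb.
pose g x := powR x (- k) * f.[x].
pose dg x := powR x (- k) * f^`().[x] + f.[x] * (- k * powR x (- k - 1)).
have dgP (x : R) : 0 < x -> is_derive x 1 g (dg x).
  by move=> x0; apply: is_deriveM; exact: is_derive1_powR.
have [||c] := @MVT R g dg a b ab.
- by move=> x; rewrite in_itv /= => /andP[ax _]; apply: dgP; exact: lt_trans ax.
- apply: derivable_within_continuous => x; rewrite in_itv /= => /andP[ax _].
  by have [] := dgP x (lt_le_trans a0 ax).
rewrite in_itv /= => /andP[ac cb] b0; exists c; first by rewrite ac.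
have c0 : 0 < c by apply: lt_trans ac.
move: b0; rewrite /g fa fb !mulr0 subrr => /esym/eqP.
rewrite mulf_eq0 [b - a == 0]subr_eq0 (gt_eqF ab) orbF => /eqP dg0.
have pc : powR c (- k) = powR c (- k - 1) * c.
  by rewrite -{3}[c]powRr1 ?ltW// -powRD ?subrK// (gt_eqF c0) implybT.
apply/rootP; rewrite !hornerE.
have /eqP : powR c (- k - 1) * (k * f.[c] - c * f^`().[c]) = - dg c.
  by rewrite /dg pc; ring.
by rewrite dg0 oppr0 mulf_eq0 (gt_eqF (powR_gt0 _ c0)) => /eqP.
Qed.

(** Rolle gives one new root in each gap between consecutive roots of [x :: s]. The bound by
    [last x s] keeps the new roots inside the original interval when operators are iterated. *)
Lemma euler_op_path (R : realType) (k : R) (f : {poly R}) (x : R) (s : seq R) :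
  0 < x -> root f x -> path <%R x s -> all (root f) s ->
  exists s' : seq R, [/\ size s' = size s, path <%R x s',
    all (fun y => y <= last x s) s' & all (root (euler_op k f)) s'].
Proof.
elim: s x => [|y s IH] x x0 fx /=; first by exists [::].
move=> /andP[xy ps] /andP[fy fs].
have [s' [ss' ps' ls' rs']] := IH y (lt_trans x0 xy) fy ps fs.
have [c /andP[xc cy] rc] := euler_op_rolle k x0 xy fx fy.
have yl : y <= last y s.
  have /allP h := lt_path_min ps.
  by have := mem_last y s; rewrite inE => /predU1P[->//|/h/ltW].
exists (c :: s'); split=> /=; rewrite ?ss' ?rc ?rs' ?xc ?ls' ?andbT//.
  by case: (s') ps' => //= z t /andP[/(lt_trans cy) -> ->].
exact: le_trans (ltW cy) yl.
Qed.

Lemma foldr_euler_op_root (R : realType) (ks : seq R) (f : {poly R}) (x b : R)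
    (s : seq R) :
  0 < x -> path <%R x s -> all (root f) (x :: s) ->
  all (fun y => y <= b) (x :: s) -> size s = size ks ->
  exists2 y, 0 < y <= b & root (foldr euler_op f ks) y.
Proof.
(* [foldr] applies the last entry of [ks] to [f] first, so the induction peels off that entry. *)
elim/last_ind: ks f x s => [|ks k IH] f x s x0.
  case: s => // _ /=; rewrite !andbT => rx xb _; exists x => //.
  by rewrite x0.
move=> ps /=/andP[rx rs] /andP[xb /allP sb]; rewrite size_rcons => ss.
have [[|y s'] [ss' ps' ls' rs']] := euler_op_path k x0 rx ps rs.
  by rewrite -ss' in ss.
rewrite foldr_rcons; apply: (IH _ y s') => //.
- by case/andP: ps' => /(lt_trans x0).
- by case/andP: ps'.
- apply/allP=> z /(allP ls') /le_trans; apply.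
  by have := mem_last x s; rewrite inE => /predU1P[->//|/sb].
- by apply: succn_inj; rewrite -ss -ss'.
Qed.

Lemma size_roots_unit_itv (R : realType) (ks : seq R) (f : {poly R}) (n : nat)
    (s : seq R) :
  (size f <= n.+1)%N ->
  \sum_(1 <= i < n.+1) `|f`_i| * `|\prod_(k <- ks) (k - i%:R)|
    < `|f`_0| * `|\prod_(k <- ks) k| ->
  uniq s -> (forall x, x \in s -> 0 < x <= 1 /\ root f x) ->
  (size s <= size ks)%N.
Proof.
move=> sf lt_sum us hs; rewrite leqNgt; apply/negP => lt_ks.
(* One root more than the number of operators, so that one root survives them all. *)
pose t := take (size ks).+1 (sort <=%R s).
have st : size t = (size ks).+1 by rewrite size_takel// size_sort.
have ts x : x \in t -> 0 < x <= 1 /\ root f x.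
  by move=> /mem_take; rewrite mem_sort => /hs.
have sort_t : sorted <%R t.
  by apply: take_sorted; rewrite sort_lt_sorted.
case: t st ts sort_t => //= x t [st] ts pt.
have [x01 _] := ts x (mem_head _ _).
have [||||y /andP[y0 y1]] := @foldr_euler_op_root R ks f x 1 t _ pt.
- by case/andP: x01.
- by apply/allP => z /ts[].
- by apply/allP => z /ts[/andP[]].
- by [].
set g := foldr _ _ _ => /rootP gy.
have sg : (size g <= n.+1)%N by apply: leq_trans sf; exact: size_foldr_euler_op.
move: lt_sum; apply/negP; rewrite -leNgt.
(* At the root [y] the constant term of [g] is minus the sum of the other terms, where the powers of
   [y] are at most 1. *)
move: gy; rewrite (horner_coef_wide _ sg) big_ord_recl /= mulr1 => /eqP.
rewrite addr_eq0 => /eqP g0.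
have -> : `|f`_0| * `|\prod_(k <- ks) k| = `|g`_0|.
  rewrite -normrM coef_foldr_euler_op mulrC; congr `|_ * _|.
  by apply: eq_bigr => k _; rewrite subr0.
rewrite g0 normrN big_add1 /= big_mkord.
apply: le_trans (ler_norm_sum _ _ _) _; apply: ler_sum => i _.
rewrite /= coef_foldr_euler_op normrM normrM [`|f`__| * _]mulrC.
have yX : y ^+ i.+1 <= 1 by rewrite exprn_ile1// ltW.
by rewrite ler_piMr ?mulr_ge0// ger0_norm// exprn_ge0// ltW.
Qed.

(** * Chebyshev polynomials of the second kind *)

(* Shifted index: [chebU l] is U_(l-1), of degree [l - 1]. *)
Fixpoint chebU {R : nzRingType} (l : nat) : {poly R} :=
  match l with
  | 0 => 0
  | l'.+1 => match l' with
             | 0 => 1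
             | l''.+1 => 'X *+ 2 * chebU l' - chebU l''
             end
  end.

Lemma chebUSS (R : nzRingType) l :
  chebU l.+2 = 'X *+ 2 * chebU l.+1 - chebU l :> {poly R}.
Proof. by []. Qed.

Lemma size_chebU (R : realDomainType) l : size (chebU l : {poly R}) = l.
Proof.
suff: size (chebU l : {poly R}) = l /\ size (chebU l.+1 : {poly R}) = l.+1.
  by case.
elim: l => [|l [IH0 IH1]]; first by rewrite size_poly0 size_poly1.
have sX : size ('X *+ 2 * chebU l.+1 : {poly R}) = l.+2.
  rewrite mulrnAl -scaler_nat size_scale ?pnatr_eq0// mulrC size_mulX ?IH1//.
  by rewrite -size_poly_gt0 IH1.
by split=> //; rewrite chebUSS size_polyDl ?size_polyN ?sX ?IH0.
Qed.

Lemma horner_chebU1 (R : comNzRingType) l : (chebU l : {poly R}).[1] = l%:R.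
Proof.
suff: (chebU l : {poly R}).[1] = l%:R /\ (chebU l.+1 : {poly R}).[1] = l.+1%:R.
  by case.
elim: l => [|l [IH0 IH1]]; first by rewrite !hornerE.
by split=> //; rewrite chebUSS !hornerE /= IH0 IH1 -[l.+2]addn2 -addn1 !natrD; ring.
Qed.

(* Pell's equation [T_l^2 + (1 - x^2) U_(l-1)^2 = 1]. *)
Lemma chebU_sqr_le (R : realDomainType) l (x : R) :
  (chebU l).[x] ^+ 2 * (1 - x ^+ 2) <= 1.
Proof.
have pell : (chebU l.+1).[x] ^+ 2 - 2 * x * (chebU l.+1).[x] * (chebU l).[x]
    + (chebU l).[x] ^+ 2 = 1.
  elim: l => [|l IH]; first by rewrite !hornerE; ring.
  by rewrite -[RHS]IH chebUSS !hornerE /=; ring.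
(* The difference U_l - x U_(l-1) is T_l, so this square is the T_l^2 of Pell's equation. *)
have := sqr_ge0 ((chebU l.+1).[x] - x * (chebU l).[x]); nra.
Qed.

Lemma chebU_cos (R : realType) l (t : R) :
  (chebU l).[cos t] * sin t = sin (l%:R * t).
Proof.
suff: (chebU l).[cos t] * sin t = sin (l%:R * t) /\
      (chebU l.+1).[cos t] * sin t = sin (l.+1%:R * t) by case.
elim: l => [|l [IH0 IH1]]; first by rewrite !hornerE sin0.
split=> //; rewrite chebUSS !hornerE /= mulrBl -mulrA IH0 IH1.
have -> : l.+2%:R * t = l.+1%:R * t + t by rewrite -[l.+2]addn1 natrD; ring.
have -> : l%:R * t = l.+1%:R * t - t by rewrite -[l.+1]addn1 natrD; ring.
by rewrite sinB sinD; ring.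
Qed.

(** The numbers cos(j pi / l) with 0 < j < l are roots by [chebU_cos], distinct because cos is
    injective on [0, pi], and as many as the degree. *)
Lemma chebU_prod (R : realType) l : (0 < l)%N ->
  exists rs : seq R, [/\ size rs = l.-1, all (fun r => r < 1) rs &
    chebU l = lead_coef (chebU l) *: \prod_(r <- rs) ('X - r%:P)].
Proof.
move=> l0; pose ang j : R := j%:R / l%:R * pi.
have l0R : 0 < l%:R :> R by rewrite ltr0n.
have pi0 := pi_gt0 R.
have ang_itv j : (0 < j < l)%N -> 0 < ang j < pi.
  move=> /andP[j0 jl]; rewrite mulr_gt0 ?divr_gt0 ?ltr0n//=.
  by rewrite gtr_pMl// ltr_pdivrMr// mul1r ltr_nat.
have cc j : (0 < j < l)%N -> ang j \in `[0, pi]%R.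
  by move=> /ang_itv/andP[h1 h2]; rewrite in_itv /= !ltW.
have sin_nat j : sin (j%:R * pi) = 0 :> R.
  elim: j => [|j IH]; first by rewrite mul0r sin0.
  by rewrite -addn1 natrD mulrDl mul1r sinDpi IH oppr0.
have mem_j j : (j \in iota 1 l.-1) = (0 < j < l)%N.
  by rewrite mem_iota add1n prednK.
exists [seq cos (ang j) | j <- iota 1 l.-1].
have sr : size [seq cos (ang j) | j <- iota 1 l.-1] = l.-1.
  by rewrite size_map size_iota.
split=> //.
  apply/allP => _ /mapP[j + ->]; rewrite mem_j => jl.
  rewrite -cos0 ltr_cos ?cc// ?in_itv /= ?lexx ?(ltW pi0)//.
  by case/andP: (ang_itv _ jl).
apply: all_roots_prod_XsubC; first by rewrite sr size_chebU prednK.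
  apply/allP => _ /mapP[j + ->]; rewrite mem_j => jl; apply/rootP/eqP.
  have /gt_eqF sj := sin_gt0_pi (ang_itv _ jl).
  have := chebU_cos l (ang j).
  have -> : l%:R * ang j = j%:R * pi by rewrite /ang mulrCA !mulrA divfK ?gt_eqF.
  by rewrite sin_nat => /eqP; rewrite mulf_eq0 sj orbF.
rewrite uniq_rootsE map_inj_in_uniq ?iota_uniq// => i j.
rewrite !mem_j => /cc ci /cc cj /(cos_inj ci cj).
rewrite /ang => /(mulIf (lt0r_neq0 pi0)) /(divIf (lt0r_neq0 l0R))/eqP.
by rewrite eqr_nat => /eqP.
Qed.

(** The entries of [ks] are the roots n(1 - r) of t |-> U_(l-1)(1 - t/n), r running over the roots
    of U_(l-1). Comparing with t = 0, where the value is U_(l-1)(1) = l, eliminates the leading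
    coefficient. *)
Lemma chebU_scaled_roots (R : realType) (l n : nat) : (0 < l)%N -> (0 < n)%N ->
  exists ks : seq R, [/\ size ks = l.-1, \prod_(k <- ks) k != 0 &
    forall i, `|\prod_(k <- ks) (k - i%:R)| * l%:R
       = `|\prod_(k <- ks) k| * `|(chebU l).[1 - i%:R / n%:R]| ].
Proof.
move=> l0 n0; have [rs [srs rs1 Urs]] := chebU_prod R l0.
have n0R : n%:R != 0 :> R by rewrite pnatr_eq0 -lt0n.
exists [seq n%:R * (1 - r) | r <- rs]; split; first by rewrite size_map.
  rewrite big_map prodf_seq_neq0; apply/allP => r /(allP rs1) r1 /=.
  by rewrite mulf_neq0// subr_eq0 gt_eqF.
move=> i; set U := chebU l in Urs *.
have UE x : U.[x] = lead_coef U * \prod_(r <- rs) (x - r).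
  rewrite Urs hornerZ horner_prod -Urs; congr (_ * _).
  by apply: eq_bigr => r _; rewrite hornerXsubC.
rewrite -[X in _ * X]normr_nat -(horner_chebU1 R l) -/U !UE !big_map.
have h x : \prod_(r <- rs) (n%:R * (1 - r) - x)
    = n%:R ^+ size rs * \prod_(r <- rs) (1 - x / n%:R - r).
  rewrite -[size rs]count_predT -iter_mulr_1 -big_const_seq -big_split /=.
  by apply: eq_bigr => r _; field.
have h0 : \prod_(r <- rs) (n%:R * (1 - r)) = n%:R ^+ size rs * \prod_(r <- rs) (1 - r).
  rewrite -[size rs]count_predT -iter_mulr_1 -big_const_seq -big_split /=.
  by apply: eq_bigr => r _; ring.
by rewrite h h0 -!normrM; congr `|_|; ring.
Qed.

(** * Positive roots of real polynomials with large end coefficients *)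

Lemma sum_inv_sqr_le (R : realFieldType) n :
  \sum_(1 <= i < n.+1) (i%:R ^+ 2)^-1 <= 2 :> R.
Proof.
case: n => [|n]; first by rewrite big_geq.
(* The correction term makes the induction close. *)
suff : \sum_(1 <= i < n.+2) (i%:R ^+ 2)^-1 <= 2 - (n.+1%:R)^-1 :> R.
  by move/le_trans; apply; rewrite gerBl invr_ge0.
elim: n => [|n IH]; first by rewrite big_nat1 expr1n invr1; lra.
rewrite big_nat_recr//=; apply: le_trans (lerD IH (lexx _)) _.
have : 0 < n.+1%:R :> R by rewrite ltr0n.
rewrite -[n.+2%:R]natr1; move: n.+1%:R => x x0.
rewrite -subr_ge0.
have -> : 2 - (x + 1)^-1 - (2 - x^-1 + ((x + 1) ^+ 2)^-1)
    = (x * (x + 1) ^+ 2)^-1.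
  by field; rewrite !gt_eqF ?addr_gt0.
by rewrite invr_ge0 mulr_ge0 ?sqr_ge0 ?ltW.
Qed.

Lemma size_roots_unit_itv_le_sqrt (R : realType) (f : {poly R}) (n : nat)
    (s : seq R) :
  (0 < n)%N -> (size f <= n.+1)%N -> f`_0 != 0 ->
  (forall i, `|f`_i| <= 2 * `|f`_0|) ->
  uniq s -> (forall x, x \in s -> 0 < x <= 1 /\ root f x) ->
  (size s)%:R <= 8 * Num.sqrt n%:R :> R.
Proof.
move=> n0 sf f0 fi us hs; set r := Num.sqrt n%:R : R.
have r0 : 0 <= r by apply: sqrtr_ge0.
have r2 : r ^+ 2 = n%:R by rewrite sqr_sqrtr.
have /andP[l1 l2] := Num.Theory.truncn_itv (mulr_ge0 (ler0n R 2) r0).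
(* Now l <= 2 sqrt n < l + 1: the upper bound limits the number of operators, and the lower one
   gives 4n <= (l + 1)^2. *)
set l := (Num.truncn (2 * r)) in l1 l2.
have [ks [sks P0 ksE]] := @chebU_scaled_roots R l.+1 n isT n0.
have nR : 0 < n%:R :> R by rewrite ltr0n.
(* The fourth power yields the decay 1/i^2, whose sum is bounded; a square would yield only 1/i and
   cost a logarithm. *)
have bound i : (0 < i <= n)%N ->
    `|\prod_(k <- ks) (k - i%:R)| ^+ 4 * 16
      <= `|\prod_(k <- ks) k| ^+ 4 * (i%:R ^+ 2)^-1.
  move=> /andP[i0 il]; have := ksE i; have := chebU_sqr_le l.+1 (1 - i%:R / n%:R : R).
  rewrite -[X in X * _ <= _]real_normK ?num_real//.
  have iR : 1 <= i%:R :> R by rewrite ler1n.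
  have inR : i%:R <= n%:R :> R by rewrite ler_nat.
  move: `|_.[_]| `|\prod_(k <- ks) (k - _)| `|\prod_(k <- ks) k|
    (normr_ge0 (\prod_(k <- ks) (k - i%:R))).
  move=> u A P A0 hu hA.
  rewrite ler_pdivlMr ?exprn_gt0 ?(lt_le_trans ltr01)//.
  (* With t = i/n in [0, 1], 1 - (1 - t)^2 = t(2 - t) >= t. *)
  have hui : u ^+ 2 * i%:R <= n%:R.
    rewrite -[leRHS]mul1r -ler_pdivrMr// -mulrA; apply: le_trans hu; rewrite ler_wpM2l ?sqr_ge0//.
    have : i%:R / n%:R <= 1 :> R by rewrite ler_pdivrMr// mul1r.
    have : 0 <= i%:R / n%:R :> R by rewrite divr_ge0.
    by move: (i%:R / n%:R) => x x0 x1; nra.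
  have hA2 : A ^+ 2 * 4 * i%:R <= P ^+ 2.
    have : A ^+ 2 * l.+1%:R ^+ 2 * i%:R <= P ^+ 2 * n%:R.
      by rewrite -exprMn hA exprMn -mulrA ler_wpM2l// sqr_ge0.
    have ll : 4 * n%:R <= l.+1%:R ^+ 2 :> R by rewrite -r2; nra.
    have : A ^+ 2 * i%:R * (4 * n%:R) <= A ^+ 2 * i%:R * l.+1%:R ^+ 2.
      by rewrite ler_wpM2l// mulr_ge0 ?sqr_ge0.
    by move=> h1 h2; rewrite -(ler_pM2r nR); nra.
  have -> : A ^+ 4 * 16 * i%:R ^+ 2 = (A ^+ 2 * 4 * i%:R) ^+ 2 by ring.
  have -> : P ^+ 4 = (P ^+ 2) ^+ 2 by ring.
  by rewrite ler_sqr// nnegrE ?sqr_ge0// !mulr_ge0// sqr_ge0.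
have P4 : 0 < `|\prod_(k <- ks) k| ^+ 4 by rewrite exprn_gt0 ?normr_gt0.
have f00 : 0 < `|f`_0| by rewrite normr_gt0.
(* Repeating [ks] four times realizes the fourth power with 4l <= 8 sqrt n operators. *)
have /= := @size_roots_unit_itv R (ks ++ ks ++ ks ++ ks) f n s sf.
have prod4 (F : R -> R) : `|\prod_(k <- ks ++ ks ++ ks ++ ks) F k|
    = `|\prod_(k <- ks) F k| ^+ 4.
  by rewrite !big_cat /= -normrX; congr `|_|; ring.
rewrite prod4 !size_cat sks => /(_ _ us hs) h.
have {h}/h : \sum_(1 <= i < n.+1) `|f`_i| *
    `|\prod_(k <- ks ++ ks ++ ks ++ ks) (k - i%:R)|
    < `|f`_0| * `|\prod_(k <- ks) k| ^+ 4.
  (* The 8 is 16 from [bound] over 2 from the coefficient bound. As the inverse squares sum to at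
     most 2, the total is at most a quarter of the right side. *)
  apply: (@le_lt_trans _ _ (\sum_(1 <= i < n.+1)
     `|f`_0| * `|\prod_(k <- ks) k| ^+ 4 / 8 * (i%:R ^+ 2)^-1)).
    apply: ler_sum_nat => i il; have := bound i il; rewrite prod4.
    have := fi i; set a := `|f`_i|; set b := `|f`_0|; move=> ab.
    set X := `|_| ^+ 4 => hX.
    have X0 : 0 <= X by rewrite exprn_ge0.
    have := ler_wpM2r X0 ab; have := ler_wpM2l (ltW f00) hX; rewrite -/b.
    by set Y := _^-1; set Z := _ ^+ 4; nra.
  rewrite -mulr_sumr; have := sum_inv_sqr_le R n; set S := \sum_(_ <= _ < _) _ => hS.
  have := mulr_gt0 f00 P4; set Q := _ * _; nra.
rewrite /= -(ler_nat R) => /le_trans; apply.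
by rewrite !natrD; lra.
Qed.

Lemma size_pos_roots_le_sqrt (R : realType) (f : {poly R}) (n : nat) (s : seq R) :
  (0 < n)%N -> (size f <= n.+1)%N -> f`_0 != 0 -> f`_n != 0 ->
  (forall i, `|f`_i| <= 2 * `|f`_0|) -> (forall i, `|f`_i| <= 2 * `|f`_n|) ->
  uniq s -> (forall x, x \in s -> 0 < x /\ root f x) ->
  (size s)%:R <= 16 * Num.sqrt n%:R :> R.
Proof.
move=> n0 sf f0 fn fi0 fin us hs.
have h1 : (size [seq x <- s | x <= 1])%:R <= 8 * Num.sqrt n%:R :> R.
  apply: (size_roots_unit_itv_le_sqrt n0 sf f0 fi0); first exact: filter_uniq.
  by move=> x; rewrite mem_filter => /andP[-> /hs[->]].
(* The reversed polynomial satisfies x^n g(1/x) = f(x), so inverses of roots of [f] above 1 are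
   roots of [g] in (0, 1]. *)
pose g := \poly_(i < n.+1) f`_(n - i).
have h2 : (size [seq x^-1 | x <- s & ~~ (x <= 1)])%:R <= 8 * Num.sqrt n%:R :> R.
  apply: (size_roots_unit_itv_le_sqrt (f := g) n0 (size_poly _ _)).
  - by rewrite coef_poly subn0.
  - move=> i; rewrite !coef_poly subn0 /=; case: ifP => _ //.
    by rewrite normr0 mulr_ge0.
  - by rewrite map_inj_uniq ?filter_uniq//; exact: invr_inj.
  move=> _ /mapP[x + ->]; rewrite mem_filter -ltNge => /andP[x1 /hs[x0 /rootP fx]].
  split; first by rewrite invr_gt0 x0 invf_le1// ltW.
  apply/rootP; rewrite horner_poly.
  have xn : x != 0 by rewrite gt_eqF.
  apply: (mulfI (expf_neq0 n xn)); rewrite mulr0 -[RHS]fx.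
  rewrite (horner_coef_wide _ sf) mulr_sumr (reindex_inj rev_ord_inj) /=.
  apply: eq_bigr => i _; have il : (i <= n)%N by rewrite -ltnS.
  rewrite subSS subKn// mulrCA; congr (_ * _).
  by rewrite -{1}(subnK il) exprD exprVn mulrAC divff ?mul1r// expf_neq0.
rewrite size_map in h2.
rewrite -(count_predC (fun x => x <= 1) s) -!size_filter natrD.
by apply: le_trans (lerD h1 h2) _; lra.
Qed.

(** * Zeros of the harmonic polynomial, counted ray by ray *)

Lemma size_le_fibers (R : numDomainType) (T U : eqType) (d : T -> U) (s : seq T)
    (B : R) :
  (forall w, w \in map d s -> (size [seq z <- s | d z == w])%:R <= B) ->
  (size s)%:R <= (size (undup (map d s)))%:R * B.
Proof.
move=> hB.
have -> : size s = (\sum_(w <- undup (map d s)) size [seq z <- s | d z == w])%N.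
  under eq_bigr do rewrite size_filter -sum1_count big_mkcond /=.
  rewrite exchange_big /= -sum1_size big_seq [RHS]big_seq.
  apply: eq_bigr => z zs; rewrite -big_mkcond sum1_count.
  rewrite (eq_count (a2 := pred1 (d z))); last by move=> w; rewrite /= eq_sym.
  by rewrite count_uniq_mem ?undup_uniq// mem_undup map_f.
rewrite natr_sum big_seq; apply: (@le_trans _ _ (\sum_(w <- undup (map d s)) B)).
  by rewrite [leRHS]big_seq; apply: ler_sum => w; rewrite mem_undup => /hB.
by rewrite big_const_seq count_predT iter_addr_0 mulr_natl.
Qed.

Section Zeros.
Variables (R : realType) (n m : nat) (q : {poly R[i]}).
Hypotheses (mn : (m < n)%N) (sq : size q = m.+1).
Hypotheses (q1 : forall k : nat, (k <= m)%N -> `|q`_k| = 1) (q0 : q`_0 = 1).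

Let ReD : {morph @complex.Re R : x y / x + y}.
Proof. by case=> [a b] [c d]. Qed.

Let ReM (a : R) (z : R[i]) : complex.Re (a%:C%C * z) = a * complex.Re z.
Proof. by case: z => x y /=; rewrite mul0r subr0. Qed.

Let Re_norm_le (z : R[i]) (a : R) : `|z| <= a%:C%C -> `|complex.Re z| <= a.
Proof. by move=> h; rewrite -lecR (le_trans (normc_ge_Re z)). Qed.

(** The norm on [R[i]] takes values in [R[i]]; the real part brings the modulus into [R]. *)
Let rad (z : R[i]) : R := complex.Re `|z|.
Let dir (z : R[i]) : R[i] := z / `|z|.

Let radE z : (rad z)%:C%C = `|z|.
Proof. by rewrite RRe_real ?normr_real. Qed.

Let rad_dir z : z != 0 -> (rad z)%:C%C * dir z = z.
Proof. by move=> z0; rewrite radE mulrC divfK// normr_eq0. Qed.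

Let n_gt0 : (0 < n)%N. Proof. exact: leq_trans mn. Qed.

Let zero_neq0 z : harm_zero ('X^n + q) q z -> z != 0.
Proof.
apply: contraPneq => ->; rewrite /harm_zero !hornerE expr0n eqn0Ngt n_gt0 add0r.
rewrite horner_coef0 q0 conjc1 => /eqP.
by rewrite -[1 + 1]/(2%:R) pnatr_eq0.
Qed.

(** At a zero, z^n is minus the sum of q(z) and its conjugate, hence real, and dividing by |z|^n
    keeps it real. *)
Let zero_dir z : harm_zero ('X^n + q) q z -> dir z ^+ n \is Num.real.
Proof.
rewrite /harm_zero !hornerE -addrA addcJ => /eqP; rewrite addr_eq0 => /eqP zn.
rewrite expr_div_n zn; apply: rpredM; last by rewrite rpredV rpredX// normr_real.
by rewrite rpredN rpredM ?rpred_nat// complex_real.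
Qed.

Let norm_dir z : z != 0 -> `|dir z| = 1.
Proof. by move=> z0; rewrite normf_div normr_id divff// normr_eq0. Qed.

Let real_norm1 (w : R[i]) : w \is Num.real -> `|w| = 1 -> w ^+ 2 = 1.
Proof. by move=> wr w1; rewrite -real_normK// w1 expr1n. Qed.

(** This is Re(z^n + 2 q(z)) at z = r w, as a polynomial in the real variable r. The 2 appears
    because q(z) and its conjugate have the same real part. *)
Let ray_poly (w : R[i]) : {poly R} :=
  \poly_(k < n.+1) complex.Re (((k == n)%:R + 2 * q`_k) * w ^+ k).

Let ray_poly_root z w : harm_zero ('X^n + q) q z -> dir z = w ->
  root (ray_poly w) (rad z).
Proof.
move=> hz dw; have z0 := zero_neq0 hz; apply/rootP.
rewrite horner_poly.
have -> : \sum_(i < n.+1) complex.Re (((i == n :> nat)%:R + 2 * q`_i) * w ^+ i)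
    * rad z ^+ i = complex.Re (z ^+ n + 2 * q.[z]).
  have sq' : (size q <= n.+1)%N by rewrite sq ltnS ltnW.
  rewrite (horner_coef_wide _ sq') mulr_sumr.
  have -> : z ^+ n = \sum_(i < n.+1) (i == n :> nat)%:R * z ^+ i.
    rewrite big_ord_recr /= eqxx mul1r big1 ?add0r// => i _.
    by rewrite ltn_eqF// mul0r.
  rewrite -big_split /= (big_morph _ ReD (erefl : complex.Re 0 = 0)).
  apply: eq_bigr => i _; rewrite -{2 3}(rad_dir z0) dw mulrC -ReM; congr complex.Re.
  by rewrite rmorphXn /= exprMn; ring.
move: hz; rewrite /harm_zero !hornerE -addrA addcJ.
rewrite !ReD => h; have := congr1 (@complex.Re R) h; rewrite ReD [RHS]/= => <-.
by congr (_ + _); case: (q.[z]) => a b /=; ring.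
Qed.

Lemma size_harm_zeros_le (s : seq R[i]) : uniq s ->
  (forall z, z \in s -> harm_zero ('X^n + q) q z) ->
  (size s)%:R <= 32 * (n%:R * Num.sqrt (n%:R : R)).
Proof.
move=> us hs.
have fib w : w \in map dir s ->
    (size [seq z <- s | dir z == w])%:R <= 16 * Num.sqrt (n%:R : R).
  move=> /mapP[z0 z0s wE].
  have w1 : `|w| = 1 by rewrite wE (norm_dir (zero_neq0 (hs _ z0s))).
  have wn : w ^+ n \is Num.real by rewrite wE (zero_dir (hs _ z0s)).
  (* Since m < n, the coefficient of [q] at n is the default 0, which leaves Re(w^n) with w^n real
     of modulus 1. *)
  have fn : `|(ray_poly w)`_n| = 1.
    rewrite coef_poly ltnSn eqxx nth_default ?sq// mulr0 addr0 mul1r.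
    have := normrX n w; rewrite w1 expr1n -(RRe_real wn) normc_def /=.
    by rewrite expr0n addr0 sqrtr_sqr => /complexI.
  have f0 : (ray_poly w)`_0 = 2.
    by rewrite coef_poly /= ltn_eqF// add0r q0 !mulr1.
  have fi i : `|(ray_poly w)`_i| <= 2.
    rewrite coef_poly; case: ltnP => // il; last by rewrite normr0.
    apply: Re_norm_le; rewrite normrM normrX w1 expr1n mulr1.
    rewrite rmorph_nat; have [->|ni] := eqVneq i n.
      by rewrite nth_default ?sq// mulr0 addr0 normr1 ler1n.
    rewrite add0r normrM normr_nat; have [im|mi] := leqP i m.
      by rewrite q1// mulr1.
    by rewrite nth_default ?sq// normr0 mulr0.
  rewrite -(size_map rad); apply: (size_pos_roots_le_sqrt (f := ray_poly w)) => //.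
  - exact: size_poly.
  - by rewrite f0 pnatr_eq0.
  - by rewrite -normr_eq0 fn oner_eq0.
  - by move=> i; rewrite f0 normr_nat (le_trans (fi i))//; lra.
  - by move=> i; rewrite fn mulr1.
  (* On a single ray the modulus determines the zero. *)
  - rewrite map_inj_in_uniq ?filter_uniq// => x y.
    rewrite !mem_filter => /andP[/eqP dx /hs/zero_neq0 x0] /andP[/eqP dy /hs/zero_neq0 y0] rxy.
    by rewrite -(rad_dir x0) -(rad_dir y0) dx dy rxy.
  move=> _ /mapP[z + ->]; rewrite mem_filter => /andP[/eqP dz /hs hz].
  split; last exact: ray_poly_root.
  by rewrite -ltcR radE normr_gt0 (zero_neq0 hz).
apply: le_trans (size_le_fibers fib) _.
(* Each w^n is real of modulus 1, so every direction is a 2n-th root of unity. With 16 sqrt n zeros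
   per ray this gives the constant 32. *)
have sd : (size (undup (map dir s)) <= n * 2)%N.
  apply: max_unity_roots; rewrite ?undup_uniq ?muln_gt0 ?n_gt0//.
  apply/allP => w; rewrite mem_undup => /mapP[z /hs hz ->].
  apply/unity_rootP; rewrite exprM real_norm1 ?(zero_dir hz)//.
  by rewrite normrX (norm_dir (zero_neq0 hz)) expr1n.
have sr := sqrtr_ge0 (n%:R : R).
have : (size (undup (map dir s)))%:R <= (n * 2)%:R :> R by rewrite ler_nat.
move/(ler_wpM2r (mulr_ge0 (ler0n R 16) sr))/le_trans; apply.
by rewrite natrM; lra.
Qed.

End Zeros.

Theorem theorem1p8 (R : realType) :
  exists C : R, 0 < C /\
  forall (n m : nat) (q : {poly R[i]}),
    (1 <= m)%N -> (m < n)%N ->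
    size q = m.+1 ->
    (forall k : nat, (k <= m)%N -> `|q`_k| = 1) ->
    q`_0 = 1 ->
    forall s : seq R[i], uniq s ->
      (forall z, z \in s -> harm_zero ('X^n + q) q z) ->
      (size s)%:R <= C * (n%:R * Num.sqrt (n%:R : R)).
Proof.
exists 32; split=> // n m q _ mn sq q1 q0 s us hs.
exact: size_harm_zeros_le mn sq q1 q0 s us hs.
Qed.
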